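(* For every $n\ge 1$, $$|\mathrm{Dom}_{T_n}(D_n)|=n^{n-1}-(n-1)!+1 .$$
   Context: $X_n=\{1,2,\dots,n\}$ is the finite chain with its usual order, and $T_n$ is the full transformation semigroup of all maps $X_n\to X_n$, written on the right and composed left to right. $D_n=\{\alpha\in T_n: x\alpha\le x \text{ for all } x\in X_n\}$ is the subsemigroup of order-decreasing maps. For a subsemigroup $U$ of a semigroup $S$, an element $d\in S$ is dominated by $U$ if for every semigroup $T$ and all semigroup homomorphisms $f,g:S\to T$ with $f|_U=g|_U$ one has $(d)f=(d)g$; the dominion $\mathrm{Dom}_S(U)$ is the set of all elements of $S$ dominated by $U$ (a subsemigroup of $S$ containing $U$). *)

(* Defs.v *)
From HB Require Import structures.
From mathcomp Require Import all_boot.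
From mathcomp Require Import boolp.

Set Implicit Arguments.
Unset Strict Implicit.
Unset Printing Implicit Defensive.

Local Open Scope group_scope.

Section Dominion.
Variables (S : semigroupType) (U : mulgClosed S).

Definition dominated (d : S) : Prop :=
  forall (T : semigroupType) (f g : {multiplicative S -> T}),
    {in U, f =1 g} -> f d = g d.

Definition dominion : {pred S} := [pred d | `[< dominated d >]].

(* A semigroupType carries a choiceType structure; classically this is no
   restriction on the codomain, as the following equivalence shows. *)
Lemma dominatedP (d : S) :
  dominated d <->
  forall (T : Type) (op : T -> T -> T), associative op ->
  forall f g : S -> T,
    {morph f : x y / x * y >-> op x y} -> {morph g : x y / x * y >-> op x y} ->
    (forall u, u \in U -> f u = g u) -> f d = g d.
Proof.
split=> [domd T op opA f g fM gM fg | domd T f g fg]; last first.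
  by apply: (domd T mul) => //; [exact: mulgA | exact: gmulfM | exact: gmulfM].
pose cT := HB.pack_for choiceType T (gen_eqMixin T) (gen_choiceMixin T).
pose sT := HB.pack_for semigroupType T (Choice.class cT)
  (isSemigroup.Build cT opA).
pose fm := HB.pack_for {multiplicative S -> sT} (f : S -> sT)
  (isMultiplicative.Build S sT f fM).
pose gm := HB.pack_for {multiplicative S -> sT} (g : S -> sT)
  (isMultiplicative.Build S sT g gM).
exact: (domd sT fm gm fg).
Qed.

End Dominion.

(* The chain {1, ..., n} is represented by 'I_n, i.e. shifted to {0, ..., n-1}.
   full_trans is a separate name so that its product is composition rather than
   the pointwise product of finite functions. *)
Definition full_trans (n : nat) : Type := {ffun 'I_n -> 'I_n}.

HB.instance Definition _ n := Finite.copy (full_trans n) {ffun 'I_n -> 'I_n}.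

Section FullTransformations.
Variable n : nat.

(* Maps act on the right: a * b is a followed by b. *)
Definition trans_mul (a b : full_trans n) : full_trans n := [ffun x => b (a x)].

Fact trans_mulA : associative trans_mul.
Proof.
move=> a b c; rewrite /trans_mul; congr finfun.
by apply: funext => x; rewrite !ffunE.
Qed.

HB.instance Definition _ := isSemigroup.Build (full_trans n) trans_mulA.

Definition order_decreasing : {pred full_trans n} :=
  [pred a : full_trans n | [forall x, a x <= x]].

Fact order_decreasing_mul_closed : mulg_closed order_decreasing.
Proof.
move=> a b /forallP ad /forallP bd; apply/forallP=> x.
by rewrite ffunE (leq_trans (bd _) (ad x)).
Qed.

HB.instance Definition _ :=
  isMulClosed.Build (full_trans n) order_decreasing order_decreasing_mul_closed.

End FullTransformations.

Arguments order_decreasing : clear implicits.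

(* Main.v *)
(* The dominion consists of the identity and the non-injective maps fixing the
   least point 0; counting maps and permutations fixing 0 gives the formula.
   The rank n - 1 idempotent i |-> j with i <> 0 is R-related to j |-> i and
   L-related to i |-> 0.  If i < j the last two are decreasing, and since two
   H-related idempotents coincide, i |-> j is dominated.  Products of these
   idempotents realise any transposition of nonzero values of a singular map,
   which leads from the decreasing map x |-> min (ker-class of x) to every
   singular map fixing 0 with the same kernel. *)
Require Import Defs.
From mathcomp Require Import all_boot.
From mathcomp Require Import perm ssralg ssrint boolp.

Set Implicit Arguments.
Unset Strict Implicit.
Unset Printing Implicit Defensive.

Lemma trans_mulE n (a b : full_trans n) x : (a * b)%g x = b (a x).
Proof. by rewrite ffunE. Qed.

(** * Closure properties of dominated elements *)

Section DominionClosure.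
Variables (S : semigroupType) (U : mulgClosed S).
Local Open Scope group_scope.

Lemma dominated_in (u : S) : u \in U -> dominated U u.
Proof. by move=> Uu T f g; apply. Qed.

Lemma dominated_mul (a b : S) :
  dominated U a -> dominated U b -> dominated U (a * b).
Proof.
by move=> doma domb T f g fg; rewrite !gmulfM (doma T f g) // (domb T f g).
Qed.

(* The images of p under the two homomorphisms are idempotents in the same
   H-class, hence equal. *)
Lemma dominated_HclassR (p e h : S) :
  dominated U e -> dominated U h ->
  p * e = e -> e * p = p -> p * h = p -> h * p = h -> dominated U p.
Proof.
move=> dome domh pe ep ph hp T f g fg.
have fge := dome T f g fg; have fgh := domh T f g fg.
(* The relations with [e] absorb [g p] on the left, those with [h] absorb [f p] on the right. *)
transitivity (g p * f p).
  by rewrite -{1}ep gmulfM fge -{1}pe gmulfM -mulgA -fge -gmulfM ep.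
by rewrite -{1}ph gmulfM -fgh -mulgA -gmulfM hp fgh -gmulfM ph.
Qed.

End DominionClosure.

(** * Necessary conditions for domination *)

Section Necessity.
Variable m : nat.
Implicit Types d e : full_trans m.+1.
Local Notation dom := (dominated (order_decreasing m.+1)).

(* Conjugate the left action of maps on integer functions by the involution
   v |-> 2 v(0) - v, which commutes exactly with the maps fixing 0. *)
Lemma dominated_fix0 d : dom d -> d ord0 = ord0.
Proof.
move=> /dominatedP domd; apply/eqP/negPn/negP => d0.
pose V := 'I_m.+1 -> int.
pose f (a : full_trans m.+1) (v : V) : V := fun x => v (a x).
pose tau (v : V) : V := fun x => (v ord0 + v ord0 - v x)%R.
pose g a v := tau (f a (tau v)).
have tauK v : tau (tau v) = v.
  by apply: funext => x; rewrite /tau GRing.addrK GRing.subKr.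
have fM a b : f (a * b)%g = f a \o f b.
  by apply: funext => v; apply: funext => x; rewrite /f /= trans_mulE.
have gM a b : g (a * b)%g = g a \o g b.
  by apply: funext => v; rewrite /g fM /= tauK.
have fg u : u \in order_decreasing m.+1 -> f u = g u.
  move=> /forallP/(_ ord0); rewrite leqn0 => /eqP u0.
  have {}u0 : u ord0 = ord0 by apply: val_inj.
  apply: funext => v; rewrite -[f u v]tauK; congr (tau _).
  by apply: funext => x; rewrite /f /tau u0.
have compA : associative (fun p q : V -> V => p \o q) by [].
(* At the point 0, [f d v] takes the value v(d 0) = 1 and [g d v] the value 2 v(0) - v(d 0) = -1. *)
pose v : V := fun x => Posz (x != ord0).
have := domd _ _ compA f g fM gM fg.
by move=> /(congr1 (fun F => F v ord0)); rewrite /g /tau /f /v d0 eqxx.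
Qed.

(** If d x < x, then d x is fixed by strong induction, so x and d x share an image. *)
Lemma decreasing_inj_id d :
  d \in order_decreasing m.+1 -> injective d -> d = [ffun x => x].
Proof.
move=> /forallP dd dI; apply/ffunP => x; rewrite ffunE.
have [k] := ubnP (val x); elim: k x => // k IH x /ltnSE xk.
have := dd x; rewrite leq_eqVlt => /orP[/eqP/val_inj //|dx].
by apply: dI; apply: IH; apply: leq_trans xk.
Qed.

(** If [d * e] is injective, so is [d]; by finiteness [d] is onto, so [e] is injective too. Hence
    the singular maps form an ideal. *)
Lemma injectiveM d e :
  injectiveb (d * e)%g = injectiveb d && injectiveb e.
Proof.
apply/injectiveP/andP => [deI|[/injectiveP dI /injectiveP eI] x y]; last first.
  by rewrite !trans_mulE => /eI/dI.
have dI : injective d by move=> x y dxy; apply: deI; rewrite !trans_mulE dxy.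
split; apply/injectiveP => // x y exy.
rewrite -(f_finv dI x) -(f_finv dI y); congr (d _).
by apply: deI; rewrite !trans_mulE !f_finv.
Qed.

(* Collapsing the singular maps to a zero sends every decreasing map to the
   identity or zero, so the further collapse of the units is not detected. *)
Lemma dominated_inj_id d : dom d -> injective d -> d = [ffun x => x].
Proof.
move=> /dominatedP domd dI.
pose T := option (full_trans m.+1).
pose op (a b : T) : T :=
  if a is Some a' then if b is Some b' then Some (a' * b')%g else None else None.
pose one : full_trans m.+1 := [ffun x => x].
pose f (a : full_trans m.+1) : T := if injectiveb a then Some a else None.
pose g (a : full_trans m.+1) : T := if injectiveb a then Some one else None.
have opA : associative op.
  by move=> [a|] [b|] [c|] //=; rewrite mulgA.
have fM : {morph f : x y / (x * y)%g >-> op x y}.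
  by move=> a b; rewrite /f injectiveM; do 2!case: injectiveb.
have one1 : (one * one)%g = one.
  by apply/ffunP => x; rewrite trans_mulE !ffunE.
have gM : {morph g : x y / (x * y)%g >-> op x y}.
  by move=> a b; rewrite /g injectiveM; do 2!case: injectiveb; rewrite //= one1.
have fg u : u \in order_decreasing m.+1 -> f u = g u.
  move=> ud; rewrite /f /g; case: injectiveP => // uI.
  by rewrite {1}(decreasing_inj_id ud uI).
by have := domd _ _ opA f g fM gM fg; rewrite /f /g; case: injectiveP => // _ [].
Qed.

End Necessity.

(** * Domination of the singular maps fixing 0 *)

Section Sufficiency.
Variable m : nat.
Implicit Types (d e : full_trans m.+1) (i j k a b : 'I_m.+1).
Local Notation dom := (dominated (order_decreasing m.+1)).

Definition collapse i j : full_trans m.+1 :=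
  [ffun x => if x == i then j else x].

Lemma collapseE i j x : collapse i j x = if x == i then j else x.
Proof. by rewrite ffunE. Qed.

Lemma collapse_decreasing i j : j <= i -> collapse i j \in order_decreasing m.+1.
Proof. by move=> ji; apply/forallP => x; rewrite collapseE; case: eqP => [->|]. Qed.

Lemma dominated_collapse i j : i != ord0 -> dom (collapse i j).
Proof.
move=> i0; have [ji|ij] := leqP j i.
  by apply: dominated_in; apply: collapse_decreasing.
have neq_ij : (i == j) = false by apply/negbTE; rewrite neq_ltn ij.
(* The first idempotent has the same kernel as [collapse i j], the second the same image, all points
   but [i]. *)
apply: (@dominated_HclassR _ _ _ (collapse j i) (collapse i ord0)).
- by apply: dominated_in; apply/collapse_decreasing/ltnW.
- by apply: dominated_in; apply/collapse_decreasing.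
all: apply/ffunP => x; rewrite trans_mulE !collapseE.
- by case: (x =P i) => [->|_]; rewrite ?eqxx ?neq_ij.
- by case: (x =P j) => [->|_]; rewrite ?eqxx // eq_sym neq_ij.
- by case: (x =P i) => [_|/eqP/negbTE->]; rewrite // eq_sym neq_ij.
- by case: (x =P i) => [_|/eqP/negbTE->]; rewrite // eq_sym (negbTE i0).
Qed.

(* As in a sliding puzzle, the unused value k is the room needed to exchange
   the values a and b. *)
Lemma dominated_swap d k a b :
  (forall x, d x != k) -> k != ord0 -> a != ord0 -> b != ord0 ->
  dom d -> dom [ffun x => tperm a b (d x)].
Proof.
move=> dk k0 a0 b0 domd.
have dkF x : (d x == k) = false := negbTE (dk x).
have [ak|ak] := eqVneq a k.
  suff -> : [ffun x => tperm a b (d x)] = (d * collapse b k)%g.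
    by apply: dominated_mul => //; apply: dominated_collapse.
  apply/ffunP => x; rewrite trans_mulE collapseE ffunE ak.
  by case: tpermP => [/eqP|->|_ /eqP/negbTE->//]; rewrite ?dkF ?eqxx.
have [bk|bk] := eqVneq b k.
  suff -> : [ffun x => tperm a b (d x)] = (d * collapse a k)%g.
    by apply: dominated_mul => //; apply: dominated_collapse.
  apply/ffunP => x; rewrite trans_mulE collapseE ffunE bk.
  by case: tpermP => [->|/eqP|/eqP/negbTE->//]; rewrite ?dkF ?eqxx.
suff -> : [ffun x => tperm a b (d x)] =
    (d * collapse a k * collapse b a * collapse k b)%g.
  by do 3![apply: dominated_mul; last exact: dominated_collapse].
apply/ffunP => x; rewrite !trans_mulE !collapseE ffunE.
case: tpermP => [->|->|/eqP/negbTE-> /eqP/negbTE->]; last by rewrite dkF.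
  by rewrite eqxx [k == b]eq_sym (negbTE bk) eqxx.
by case: (b =P a) => [->|_]; rewrite ?eqxx ?[k == a]eq_sym (negbTE ak) ?eqxx.
Qed.

(** Induction on the number of disagreements: exchanging the values [d x] and [e x] repairs [x], and
    the same exchange leads back to [d]. *)
Lemma dominated_kernel d e :
  d ord0 = ord0 -> ~ injective d -> e ord0 = ord0 ->
  (forall x y, (d x == d y) = (e x == e y)) -> dom e -> dom d.
Proof.
move=> + + e0 + dome.
have [k] := ubnP #|[pred x | d x != e x]|.
elim: k d => // k IH d /ltnSE dk d0 dI de.
have [/existsP[x dx]|/existsPn/= deq] := boolP [exists x, d x != e x]; last first.
  suff -> : d = e by [].
  by apply/ffunP => x; apply/eqP/negPn/deq.
have zero y : (d y == ord0) = (e y == ord0) by have := de y ord0; rewrite d0 e0.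
have ex0 : e x != ord0.
  by apply: contraNneq dx => ex0; rewrite ex0 zero ex0.
have dx0 : d x != ord0 by rewrite zero.
pose s := tperm (d x) (e x).
pose d' : full_trans m.+1 := [ffun y => s (d y)].
have d'E y : d' y = s (d y) by rewrite ffunE.
have s0 : s ord0 = ord0 by rewrite /s tpermD.
have d'0 : d' ord0 = ord0 by rewrite d'E d0.
have d'I : ~ injective d'.
  by move=> d'I; apply: dI => y z dyz; apply: d'I; rewrite !d'E dyz.
have domd' : dom d'.
  apply: IH => //; last by move=> y z; rewrite !d'E (inj_eq perm_inj).
  (* No agreement is lost: if d y = e y were [d x] or [e x], equal kernels would force d x = e x. *)
  apply: leq_trans dk; apply/proper_card/properP; split.
    apply/subsetP => y; rewrite !inE d'E; apply: contraNneq => dey.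
    rewrite /s tpermD ?dey //; apply: contraNneq dx.
      by move=> dxy; rewrite dxy eq_sym -de dxy dey.
    by move=> exy; rewrite exy -dey de exy.
  by exists x; rewrite !inE // d'E tpermL eqxx.
(* A singular map misses a value, which is nonzero because 0 is attained at 0. *)
have [j jd'] : exists j, j \notin codom d'.
  apply/existsP; apply: contra_notT d'I => /existsPn d'S.
  have /image_injP d'I : #|codom d'| == #|'I_m.+1|.
    by apply/eqP/eq_card => j; rewrite inE; apply/negPn/d'S.
  by move=> y z; apply: d'I.
have -> : d = [ffun y => s (d' y)].
  by apply/ffunP => y; rewrite ffunE d'E tpermK.
apply: (dominated_swap (k := j)) => //.
  by move=> y; apply: contraNneq jd' => <-; apply: codom_f.
by apply: contraNneq jd' => ->; rewrite -d'0 codom_f.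
Qed.

Lemma dominated_singular d : d ord0 = ord0 -> ~ injective d -> dom d.
Proof.
move=> d0 dI.
pose e : full_trans m.+1 := [ffun x => [arg min_(y < x | d y == d x) val y]].
have eP x : d (e x) = d x /\ forall y, d y = d x -> e x <= y.
  by rewrite ffunE; case: arg_minnP => // y /eqP -> ymin; split=> // z /eqP /ymin.
apply: (dominated_kernel (e := e)) => //.
- by apply: val_inj; apply/eqP; rewrite /= -leqn0; apply: (eP ord0).2 ord0 _.
- move=> x y; apply/eqP/eqP => [dxy|exy]; last first.
    by rewrite -(eP x).1 -(eP y).1 exy.
  apply: val_inj; apply/eqP; rewrite eqn_leq.
  by rewrite (eP x).2 ?(eP y).2 // ?(eP x).1 ?(eP y).1.
- by apply: dominated_in; apply/forallP => x; apply: (eP x).2.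
Qed.

End Sufficiency.

(** * Description and size of the dominion *)

Lemma in_dominion_decreasing m :
  dominion (order_decreasing m.+1) =i
  [pred d : full_trans m.+1 |
    (d ord0 == ord0) && ((d == [ffun x => x]) || ~~ injectiveb d)].
Proof.
move=> d; rewrite [RHS]inE.
apply/asboolP/andP => [domd|[/eqP d0 /orP[/eqP->|/injectiveP]]].
- split; first by apply/eqP/dominated_fix0.
  by rewrite orbC -implybE; apply/implyP => /injectiveP /(dominated_inj_id domd) ->.
- by apply: dominated_in; apply/forallP => x; rewrite ffunE.
- exact: dominated_singular.
Qed.

Lemma card_fix0 m :
  #|[pred d : {ffun 'I_m.+1 -> 'I_m.+1} | d ord0 == ord0]| = m.+1 ^ m.
Proof.
(* With default value 0, fixing 0 means that the support avoids 0. *)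
have <- : #|pffun_on ord0 (predC1 (@ord0 m)) 'I_m.+1| = m.+1 ^ m.
  by rewrite card_pffun_on cardC1 card_ord.
apply: eq_card => d; rewrite inE; apply/eqP/pffun_onP => [d0|[/subsetP dD _]].
  by split=> //; apply/subsetP => x; rewrite !inE; apply: contraNneq => ->; rewrite d0.
by apply/eqP/negPn/negP => d0; have := dD ord0; rewrite !inE d0 eqxx => /(_ isT).
Qed.

Lemma card_fix0_inj m :
  #|[pred d : {ffun 'I_m.+1 -> 'I_m.+1} | (d ord0 == ord0) && injectiveb d]| = m`!.
Proof.
have <- : #|perm_on [set~ @ord0 m]| = m`!.
  by rewrite card_perm cardsC1 card_ord.
rewrite -(card_image (f := @pval 'I_m.+1) val_inj).
apply: eq_card => d; rewrite inE; apply/andP/imageP => [[/eqP d0 /injectiveP dI]|].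
  exists (perm dI); last by apply/ffunP => x; rewrite pvalE permE.
  by apply/subsetP => x; rewrite !inE permE; apply: contraNneq => ->; rewrite d0.
move=> [s /subsetP sD ->]; rewrite pvalE; split; last exact/injectiveP/perm_inj.
by apply/negPn/negP => s0; have := sD ord0; rewrite !inE s0 eqxx => /(_ isT).
Qed.

Theorem lemma2p7 (n : nat) (n_ge1 : 1 <= n) :
  #|dominion (order_decreasing n)| = n ^ (n - 1) - (n - 1)`! + 1.
Proof.
case: n n_ge1 => // m _; rewrite subn1 /=.
rewrite -card_fix0 -card_fix0_inj (eq_card (@in_dominion_decreasing m)).
set A := [pred d : {ffun _} | d ord0 == ord0].
set I := [pred d : {ffun 'I_m.+1 -> 'I_m.+1} | injectiveb d].
(* The difference counts the singular maps fixing 0; splitting the identity off the dominion gives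
   the summand 1. *)
rewrite -(cardID I A) addKn addnC (cardD1 [ffun x => x]).
congr (_ + _); first by rewrite inE ffunE !eqxx.
apply: eq_card => d; rewrite !inE.
case: eqP => [->|_] /=; last by rewrite andbC.
suff -> : injectiveb [ffun x : 'I_m.+1 => x] by [].
by apply/injectiveP => x y; rewrite !ffunE.
Qed.
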